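(* Let $n\ge 1$ and $k\ge 1$ be integers and let $C$ be an $(n,k)$ circuit code of length $N\ge 2(k+1)$. Then there exists an $(n+r,k+1)$ circuit code $C'$ of length $N'=N+2\left\lceil \frac{N}{2(k+1)}\right\rceil$, where $r=\left\lceil \log_2 \frac{N}{2(k+1)}\right\rceil+1$.
   Context: $I(n)$ denotes the graph of the $n$-dimensional hypercube: vertices are binary vectors of length $n$, two vertices adjacent iff they differ in exactly one coordinate. For an induced subgraph $G$ of $I(n)$ and vertices $x,x'$ of $G$, $d_G(x,x')$ is the number of edges of a shortest path from $x$ to $x'$ in $G$ ($\infty$ if none); $d_{I(n)}(x,x')$ is the Hamming distance. An induced subgraph $C$ of $I(n)$ is an $(n,k)$ circuit code (circuit code of spread $k$) if $C$ is a cycle and for all vertices $x,x'$ of $C$ with $d_{I(n)}(x,x')<k$ we have $d_C(x,x')=d_{I(n)}(x,x')$. The length of a circuit code is its number of vertices (equivalently edges). *)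

(* Defs.v *)
From HB Require Import structures.
From mathcomp Require Import all_boot all_order all_algebra.
From mathcomp Require Import boolp reals exp.
Set Implicit Arguments.
Unset Strict Implicit.
Unset Printing Implicit Defensive.
Import Order.TTheory GRing.Theory Num.Theory.

Definition cube (n : nat) := n.-tuple bool.

Definition hamming (n : nat) (x y : cube n) : nat :=
  #|[set i : 'I_n | tnth x i != tnth y i]|.

Definition cube_adj (n : nat) : rel (cube n) :=
  [rel x y | hamming x y == 1].

(* An induced subgraph is given by its vertex set. *)
Definition induced (T : finType) (e : rel T) (V : {set T}) : rel T :=
  [rel x y | [&& x \in V, y \in V & e x y]].

Definition has_path (T : finType) (e : rel T) (x y : T) (m : nat) : bool :=
  [exists p : m.-tuple T, [&& path e x p, uniq (x :: p) & last x p == y]].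

(* Number of edges of a shortest path; None stands for infinity. *)
Definition gdist (T : finType) (e : rel T) (x y : T) : option nat :=
  match pselect (exists m, has_path e x y m) with
  | left h => Some (ex_minn h)
  | right _ => None
  end.

(* The graph (V, e) is a cycle graph: s lists its vertices in cyclic order,
   and the edges are exactly the pairs of cyclically consecutive vertices. *)
Definition is_cycle (T : finType) (e : rel T) (V : {set T}) : Prop :=
  exists s : seq T,
    [/\ 2 < size s, uniq s, V = [set x in s] &
        {in V &, forall x y, e x y = (y == next s x) || (x == next s y)}].

Definition circuit_code (n k : nat) (C : {set cube n}) : Prop :=
  is_cycle (induced (@cube_adj n) C) C /\
  {in C &, forall x x', hamming x x' < k ->
     gdist (induced (@cube_adj n) C) x x' = Some (hamming x x')}.

Definition log2 (R : realType) (x : R) : R := (ln x / ln 2)%R.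

(* Main.v *)
Require Import Defs.
From HB Require Import structures.
From mathcomp Require Import all_boot all_order all_algebra.
From mathcomp Require Import boolp reals exp.
From mathcomp Require Import zify lra.
Import Order.TTheory GRing.Theory Num.Theory.
Set Implicit Arguments.
Unset Strict Implicit.
Unset Printing Implicit Defensive.

(** View a circuit code of length [N] as an [N]-periodic walk.  Cut each of its
    two halves, of length [h = N / 2], into [m = ceil (h / (k + 1))] segments of
    [k + 1] edges, the last one possibly shorter, and after every segment insert
    an edge in the [r] new coordinates, so that these edges together run once
    through a cycle of length [2 m <= 2 ^ r] in the [r]-cube.  Two vertices whose
    arc uses no new edge lie in one segment, and parity improves the distance
    bound [k] to [k + 1].  An arc using one or two new edges gains one or two
    from the new coordinates.  An arc using at least three contains two
    consecutive segments, at least one of them full, hence at least [k] old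
    edges, and any gain from the new coordinates suffices. *)

(** * Hamming distance and its parity *)

Lemma hammingE n (x y : cube n) : hamming x y = \sum_i (tnth x i != tnth y i).
Proof.
rewrite /hamming -sum1_card big_mkcond.
by apply: eq_bigr => i _; rewrite inE; case: (_ != _).
Qed.

Lemma hammingC n (x y : cube n) : hamming x y = hamming y x.
Proof. by rewrite !hammingE; apply: eq_bigr => i _; rewrite eq_sym. Qed.

Lemma hamming_eq0 n (x y : cube n) : (hamming x y == 0) = (x == y).
Proof.
rewrite hammingE sum_nat_eq0; apply/forallP/eqP => [h|-> i]; last by rewrite eqxx.
by apply: eq_from_tnth => i; have := h i; rewrite /= eqb0 negbK => /eqP.
Qed.

Lemma hamming_xx n (x : cube n) : hamming x x = 0.
Proof. by apply/eqP; rewrite hamming_eq0. Qed.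

(** The triangle inequality together with its parity: [c] counts the coordinates flipped on both
    legs. *)
Lemma hamming_add n (x y z : cube n) :
  exists c, hamming x y + hamming y z = hamming x z + c.*2.
Proof.
exists (\sum_i ((tnth x i != tnth y i) && (tnth y i != tnth z i))).
rewrite !hammingE -muln2 big_distrl /= -!big_split /=; apply: eq_bigr => i _.
by case: (tnth x i); case: (tnth y i); case: (tnth z i).
Qed.

Lemma hamming_cat n p (x y : cube n) (u v : cube p) :
  hamming [tuple of x ++ u] [tuple of y ++ v] = hamming x y + hamming u v.
Proof.
rewrite !hammingE big_split_ord /=.
by congr (_ + _); apply: eq_bigr => i _; rewrite ?tnth_lshift ?tnth_rshift.
Qed.

Lemma hamming_cons n (a b : bool) (x y : cube n) :
  hamming [tuple of a :: x] [tuple of b :: y] = (a != b) + hamming x y.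
Proof.
rewrite !hammingE big_ord_recl !tnth0; congr (_ + _).
by apply: eq_bigr => i _; rewrite !tnthS.
Qed.

(** * Periodic walks in the cube *)

Definition closed_walk n N (s : nat -> cube n) :=
  (forall i, s (i + N) = s i) /\ (forall i, hamming (s i) (s i.+1) = 1).

(* For [d.*2 <= N], [d] is the distance from [i] to [i + d] on the cycle of length [N]. *)
Definition spread n k N (s : nat -> cube n) :=
  forall i d, d.*2 <= N -> minn d k <= hamming (s i) (s (i + d)).

Lemma walk_parity n (s : nat -> cube n) i d :
  (forall i, hamming (s i) (s i.+1) = 1) -> odd (hamming (s i) (s (i + d))) = odd d.
Proof.
move=> s1; elim: d => [|d IH].
  by rewrite addn0 hamming_xx.
have [c] := hamming_add (s i) (s (i + d)) (s (i + d.+1)).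
rewrite addnS s1 => /(congr1 odd); rewrite !oddD odd_double addbF IH => <- /=.
by rewrite addbT.
Qed.

Lemma walk_mod n N (s : nat -> cube n) i :
  (forall i, s (i + N) = s i) -> s (i %% N) = s i.
Proof.
move=> sN; rewrite {2}(divn_eq i N) addnC.
by elim: (i %/ N) => [|a IH]; rewrite ?addn0 // mulSn (addnC N) addnA sN.
Qed.

Lemma eqmod_walk n N (s : nat -> cube n) i j :
  (forall i, s (i + N) = s i) -> i = j %[mod N] -> s i = s j.
Proof. by move=> sN e; rewrite -(walk_mod i sN) e walk_mod. Qed.

Lemma cyclic_dist N i j : 0 < N ->
  exists2 d, d.*2 <= N & i + d = j %[mod N] \/ j + d = i %[mod N].
Proof.
move=> N0; wlog le_ij : i j / i %% N <= j %% N.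
  move=> W; case: (leqP (i %% N) (j %% N)) => [|/ltnW] /W //.
  by case=> d dN [] ?; exists d => //; [right|left].
have jN := ltn_pmod j N0; have iN := ltn_pmod i N0.
set e := j %% N - i %% N.
have [eN|eN] := leqP e.*2 N.
  by exists e => //; left; rewrite -modnDml subnKC // modn_mod.
(* Otherwise the complementary arc, run from [j] to [i], is the shorter one. *)
exists (N - e); first by lia.
by right; rewrite -modnDml (_ : _ + _ = i %% N + N) ?modnDr ?modn_mod // /e; lia.
Qed.

(** A closed walk may revisit vertices, but positive spread forbids it: an arc of [d] edges joining
    equal vertices gives [minn d k <= 0], so [d = 0]. *)
Lemma walk_inj n k N (s : nat -> cube n) i j : 0 < N -> 0 < k ->
  closed_walk N s -> spread k N s -> s i = s j -> i = j %[mod N].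
Proof.
move=> N0 k0 [sN _] sk; wlog [d dN h] : i j / exists2 d, d.*2 <= N & i + d = j %[mod N].
  move=> W e; have [d dN [] h] := cyclic_dist i j N0; first by apply: W => //; exists d.
  by apply/esym/W => //; exists d.
rewrite -(eqmod_walk sN h) => e; have := sk i d dN.
by rewrite -e hamming_xx -h; case: d {dN h e} => [|d]; rewrite ?addn0 //; lia.
Qed.

(** * From a circuit code to a periodic walk *)

Lemma next_nth_mod (T : eqType) (x0 : T) (t : seq T) i : 0 < size t -> uniq t ->
  next t (nth x0 t (i %% size t)) = nth x0 t (i.+1 %% size t).
Proof.
move=> t0 ut; have it := ltn_pmod i t0; rewrite next_nth mem_nth // index_uniq //.
rewrite -[i.+1]addn1 -modnDml addn1; move: (i %% size t) it => {}i.
case: t t0 ut => //= y t _ _; rewrite ltnS leq_eqVlt => /predU1P[->|lt_i].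
  by rewrite modnn nth_default.
by rewrite modn_small //; apply: set_nth_default.
Qed.

(** The point is that no path in [C] beats the shorter arc: its steps go forward or backward along
    the cycle, and their balance is congruent to [d]. *)
Lemma code_walk n k C : 0 < k -> @circuit_code n k C ->
  exists2 s : nat -> cube n, closed_walk #|C| s & spread k #|C| s.
Proof.
move=> k0 [[t [t2 ut eC eE]] hC].
pose x0 : cube n := [tuple of nseq n false].
have eN : #|C| = size t by rewrite eC cardsE; apply/card_uniqP.
rewrite eN; set N := size t in t2 *; have N0 : 0 < N by lia.
pose s i := nth x0 t (i %% N).
have sC i : s i \in C by rewrite eC inE mem_nth // ltn_pmod.
have sE x : x \in C -> exists i, x = s i.
  rewrite eC inE => xt; exists (index x t).
  by rewrite /s modn_small ?index_mem // nth_index.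
have sS i : next t (s i) = s i.+1 by apply: next_nth_mod.
have sN i : s (i + N) = s i by rewrite /s modnDr.
have sI i j : s i = s j -> i = j %[mod N].
  by move/eqP; rewrite nth_uniq ?ltn_pmod // => /eqP.
have adjE i j : induced (@cube_adj n) C (s i) (s j) = (s j == s i.+1) || (s i == s j.+1).
  by rewrite eE // !sS.
exists s.
  split=> // i; have := adjE i i.+1; rewrite eqxx /= => /and3P[_ _ /eqP]; exact.
move=> i d dN; case: (ltnP (hamming (s i) (s (i + d))) k); last by lia.
move=> lt_k; have := hC _ _ (sC i) (sC (i + d)) lt_k.
rewrite /gdist; case: pselect => // ex; case: ex_minnP => m /existsP[p] /and3P[pp _ /eqP lp] _ [em].
suff : d <= m by rewrite em; lia.
rewrite -(size_tuple p); move: (tval p) pp lp => {em}p pp lp.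
(* [a] counts forward steps and [b] backward ones; a backward step is written as [N.-1] forward
   steps to stay in the naturals. *)
have : exists a b, a + b = size p /\ last (s i) p = s (i + a + b * N.-1).
  elim/last_ind: p pp {lp} => [|q y IH] /=.
    by exists 0, 0; rewrite !addn0.
  rewrite rcons_path last_rcons size_rcons => /andP[/IH[a [b [<- ->]]] ay].
  have [z ez] : exists z, y = s z by apply: sE; case/and3P: ay.
  move: ay; rewrite {}ez adjE => /orP[] /eqP e.
    by exists a.+1, b; rewrite e addnS addSn; split.
  exists a, b.+1; rewrite addnS; split=> //; apply: (eqmod_walk sN).
  have /eqP := sI _ _ e; rewrite -(eqn_modDr N.-1) => /eqP h.
  by rewrite mulSn addnCA addnC h addSnnS prednK // modnDr.
case=> a [b [<-]]; rewrite lp => /sI; rewrite -addnA => /eqP; rewrite eqn_modDl.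
rewrite -(eqn_modDr b) (_ : a + _ + b = b * N + a); last first.
  by rewrite addnAC -addnA addnC -mulnS prednK.
(* Now [d + b] and [a] agree modulo [N], but [a + b < d] would give [0 < d + b - a < 2 * d <= N]. *)
rewrite modnMDl; apply: contraTT; rewrite -ltnNge => lt_d.
rewrite eqn_mod_dvd; last by lia.
by apply/negP => /dvdn_leq; lia.
Qed.

(** * From a periodic walk back to a circuit code *)

Lemma has_path_walk (T : finType) (e : rel T) (f : nat -> T) d :
  (forall l, l < d -> e (f l) (f l.+1)) ->
  (forall l l', l <= d -> l' <= d -> f l = f l' -> l = l') ->
  has_path e (f 0) (f d) d.
Proof.
move=> fe fI; apply/existsP; exists [tuple of [seq f l | l <- iota 1 d]]; apply/and3P; split.
- apply/(pathP (f 0)) => i; rewrite /= size_map size_iota => lt_i.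
  have nthE m q : i < q -> nth (f 0) [seq f l | l <- iota m q] i = f (m + i).
    by move=> iq; rewrite (nth_map 0) ?size_iota // nth_iota.
  by rewrite -[f 0 :: _]/(map f (iota 0 d.+1)) !nthE ?leqW //; apply: fe.
- rewrite -[f 0 :: _]/(map f (iota 0 d.+1)) map_inj_in_uniq ?iota_uniq //.
  by move=> i j; rewrite !mem_iota !add0n !ltnS; apply: fI.
- by rewrite /= last_map -nth_last size_iota; case: d {fe fI} => // d; rewrite nth_iota.
Qed.

Lemma path_hamming n (e : rel (cube n)) x p :
  subrel e (@cube_adj n) -> path e x p -> hamming x (last x p) <= size p.
Proof.
move=> eA; elim: p x => [|y p IH] x /=; first by rewrite hamming_xx.
case/andP=> /eA /eqP xy /IH; have [c] := hamming_add x y (last y p); lia.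
Qed.

(** Spread above 1 excludes chords, so the visited vertices induce a cycle. For Hamming distance
    below [k], spread makes the shorter arc no longer than that distance, and no path is shorter
    than it. *)
Lemma walk_code n k N (s : nat -> cube n) : 1 < k -> 2 < N ->
  closed_walk N s -> spread k N s ->
  circuit_code k [set s (val i) | i : 'I_N] /\ #|[set s (val i) | i : 'I_N]| = N.
Proof.
move=> k1 N2 ws sk; set C := [set _ | i in _].
have N0 : 0 < N by lia.
have [sN s1] := ws.
have sI i j : s i = s j -> i = j %[mod N] by apply: walk_inj ws sk; lia.
have sC i : s i \in C.
  by rewrite -(walk_mod i sN); apply/imsetP; exists (Ordinal (ltn_pmod i N0)).
have sE x : x \in C -> exists i, x = s i by case/imsetP=> i _ ->; exists i.
have adjE x y : induced (@cube_adj n) C x y = [&& x \in C, y \in C & hamming x y == 1].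
  by [].
have adj1 i : induced (@cube_adj n) C (s i) (s i.+1).
  by apply/and3P; split; [exact: sC | exact: sC | apply/eqP; exact: s1].
have adjC : symmetric (induced (@cube_adj n) C).
  by move=> x y; rewrite !adjE hammingC andbCA.
split; last first.
  rewrite card_imset ?card_ord // => i j /sI.
  by rewrite !modn_small ?ltn_ord // => /val_inj.
have um : uniq (mkseq s N).
  rewrite map_inj_in_uniq ?iota_uniq // => i j; rewrite !mem_iota !add0n => /= iN jN /sI.
  by rewrite !modn_small.
split.
  exists (mkseq s N); rewrite size_mkseq; split=> //.
  - apply/setP=> x; rewrite inE; apply/imsetP/mapP => [[i _ ->]|[i]].
      by exists (val i); rewrite // mem_iota add0n /=.
    by rewrite mem_iota add0n /= => iN ->; exists (Ordinal iN).
  move=> x y xC yC; have [[i ->] [j ->]] := (sE _ xC, sE _ yC).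
  have nx l : next (mkseq s N) (s l) = s l.+1.
    have := @next_nth_mod _ (s 0) (mkseq s N) l; rewrite size_mkseq !nth_mkseq ?ltn_pmod //.
    by rewrite !(walk_mod _ sN) => -> //.
  rewrite adjE !nx !sC !andTb; apply/eqP/orP => [h1|[] /eqP ->]; last first.
  - by rewrite hammingC.
  - by [].
  have [d dN [] h] := cyclic_dist i j N0; have e := eqmod_walk sN h; rewrite -e in h1 *.
  - have := sk i d dN; rewrite h1; case: d {dN h e} h1 => [|[|d]] h1; last by lia.
      by rewrite addn0 hamming_xx in h1.
    by left; rewrite addn1.
  - have := sk j d dN; rewrite hammingC h1; case: d {dN h e} h1 => [|[|d]] h1; last by lia.
      by rewrite addn0 hamming_xx in h1.
    by right; rewrite addn1.
(* Both orientations are needed, since [cyclic_dist] does not fix the end at which the shorter arc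
   starts. *)
have step i d (dN : d.*2 <= N) : has_path (induced (@cube_adj n) C) (s i) (s (i + d)) d /\
    has_path (induced (@cube_adj n) C) (s (i + d)) (s i) d.
  have inj l l' : l <= d -> l' <= d -> s (i + l) = s (i + l') -> l = l'.
    by move=> ld ld' /sI/eqP; rewrite eqn_modDl !modn_small => [/eqP||]; lia.
  split.
    rewrite -{1}[i]addn0; apply: (@has_path_walk _ _ (fun l => s (i + l))) => //.
    by move=> l _; rewrite addnS.
  have := @has_path_walk _ (induced (@cube_adj n) C) (fun l => s (i + (d - l))) d.
  rewrite subn0 subnn addn0; apply=> [l ld|l l' ld ld' /inj]; last by lia.
  by rewrite adjC -[d - l]prednK ?subn_gt0 // -subnS addnS.
move=> x y xC yC lt_k; have [[i ex] [j ey]] := (sE _ xC, sE _ yC).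
have [d dle hp] : exists2 d, d <= hamming x y & has_path (induced (@cube_adj n) C) x y d.
  have [d dN [] h] := cyclic_dist i j N0; have e := eqmod_walk sN h; exists d.
  - by have := sk i d dN; rewrite e -ex -ey; lia.
  - by rewrite ex ey -e; case: (step i d dN).
  - by have := sk j d dN; rewrite e -ex -ey hammingC; lia.
  - by rewrite ex ey -e; case: (step j d dN).
rewrite /gdist; case: pselect => [ex1|[]]; last by exists d.
case: ex_minnP => m /existsP[p /and3P[pp _ /eqP lp]] /(_ _ hp) le_m; congr Some.
have := @path_hamming _ (induced (@cube_adj n) C) x p _ pp; rewrite lp size_tuple.
suff sub : subrel (induced (@cube_adj n) C) (@cube_adj n) by move=> /(_ sub); lia.
by move=> u v /and3P[].
Qed.

(** * Gray codes and cycles of even length in the cube *)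

Definition snake r m (g : nat -> cube r) :=
  (forall i, i.+1 < m -> hamming (g i) (g i.+1) = 1) /\
  (forall i j, i < m -> j < m -> g i = g j -> i = j).

(** The reflection step of the binary Gray code, for any length [m] so that it also serves to close
    a cycle of length [m.*2]. *)
Definition reflected r m (g : nat -> cube r) (j : nat) : cube r.+1 :=
  if j < m then [tuple of false :: g j] else [tuple of true :: g (m.*2.-1 - j)].

Lemma snake_reflected r m (g : nat -> cube r) : snake m g -> snake m.*2 (reflected m g).
Proof.
case=> g1 gI; split=> [i im|i j im jm]; rewrite /reflected.
  case: (ltnP i.+1 m) => [lt_i|ge_i].
    by rewrite (ltnW lt_i) hamming_cons /= add0n g1.
  case: (ltnP i m) => [lt_i|le_i]; rewrite hamming_cons /=.
    (* At the turn both sides carry [g m.-1], so only the new bit changes. *)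
    by rewrite (_ : _ - _ = i) ?hamming_xx //; lia.
  by rewrite add0n hammingC (_ : m.*2.-1 - i = (m.*2.-1 - i.+1).+1) ?g1 //; lia.
case: (ltnP i m) => im'; case: (ltnP j m) => jm' // /(congr1 val) /= [] /val_inj /gI; lia.
Qed.

Lemma gray_code r : exists g : nat -> cube r, snake (2 ^ r) g.
Proof.
elim: r => [|r [g gP]].
  by exists (fun=> [tuple]); split=> [] // [|i] // [|j].
by exists (reflected (2 ^ r) g); rewrite expnS mul2n; apply: snake_reflected.
Qed.

(** Reflecting the first [m] vertices of a Gray code gives a path whose two ends both carry [g 0]
    and differ only in the new bit, so it closes up. *)
Lemma cube_cycle r m : 0 < m -> m <= 2 ^ r ->
  exists2 w : nat -> cube r.+1, closed_walk m.*2 w &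
    forall i d, 0 < d < m.*2 -> w i != w (i + d).
Proof.
move=> m0 mr; have [g [g1 gI]] := gray_code r.
have gP : snake m g by split=> [i ?|i j ? ?]; [apply: g1 | apply: gI]; lia.
have [w1 wI] := snake_reflected gP; set w := reflected m g in w1 wI *.
have M0 : 0 < m.*2 by lia.
exists (fun i => w (i %% m.*2)); first split=> [i|i]; first by rewrite modnDr.
  have iM := ltn_pmod i M0; rewrite -[i.+1]addn1 -modnDml addn1.
  move: iM; rewrite leq_eqVlt => /predU1P[im|im]; last by rewrite (modn_small im) w1.
  rewrite im modnn (_ : i %% _ = m.*2.-1) ?/w /reflected; last by rewrite -[in RHS]im.
  by rewrite m0 ltnNge (_ : m <= _) ?hamming_cons ?subnn ?hamming_xx //; lia.
move=> i d /andP[d0 dm]; apply/eqP => /wI; rewrite !ltn_pmod // => /(_ isT isT)/eqP.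
by rewrite -{1}(addn0 i) eqn_modDl mod0n modn_small //; lia.
Qed.

(** Two steps give an even distance of at most 2, nonzero by hypothesis. *)
Lemma hamming_step2 n (w : nat -> cube n) i :
  (forall i, hamming (w i) (w i.+1) = 1) -> w i != w (i + 2) -> hamming (w i) (w (i + 2)) = 2.
Proof.
move=> w1; rewrite -hamming_eq0; have := walk_parity i 2 w1.
have [c] := hamming_add (w i) (w i.+1) (w i.+2); rewrite !w1 addn2; lia.
Qed.

(** * Inserting the new edges into the walk *)

Section Expansion.

Variables (k h m : nat).
Hypotheses (m0 : 0 < m) (lt_h : m.-1 * k.+1 < h) (le_h : h <= m * k.+1).

(* The number of inserted edges before position [p] of the new walk; one half of
   the new walk has [h + m] edges. *)
Definition crossings p := p %/ (h + m) * m + p %% (h + m) %/ k.+2.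

Lemma crossingsDr p : crossings (p + (h + m)) = crossings p + m.
Proof. by rewrite /crossings modnDr divnDr // divnn addn_gt0 m0 orbT /=; lia. Qed.

Lemma crossingsS p : crossings p <= crossings p.+1 <= (crossings p).+1.
Proof.
have H0 : 0 < h + m by lia.
have qH := ltn_pmod p H0; rewrite /crossings.
have [e1 e2] : p.+1 %/ (h + m) = p %/ (h + m) + (p %% (h + m)).+1 %/ (h + m)
  /\ p.+1 %% (h + m) = (p %% (h + m)).+1 %% (h + m).
  by split; [rewrite {1}(divn_eq p (h + m)) -addnS divnMDl | rewrite -addn1 -modnDml addn1].
rewrite {}e1 {}e2; move: (p %/ _) (p %% _) qH => a q; rewrite leq_eqVlt => /predU1P[e|lt_q].
  (* At the last position of a half the quotient is [m.-1], so entering the next half adds exactly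
     one. *)
  rewrite e modnn divnn H0 div0n.
  have -> : q %/ k.+2 = m.-1 by nia.
  lia.
rewrite (divn_small lt_q) (modn_small lt_q) addn0.
have := divn_eq q k.+2; have := divn_eq q.+1 k.+2.
have := ltn_pmod q (ltn0Sn k.+1); have := ltn_pmod q.+1 (ltn0Sn k.+1); nia.
Qed.

(** Position [p] lies in half [a], segment [j], at offset [u]; a full segment with its new edge
    takes [k.+2] edges. *)
Lemma crossings_decomp p : exists a j u,
  [/\ p = a * (h + m) + (j * k.+2 + u), j * k.+2 + u < h + m, u < k.+2, j < m
    & crossings p = a * m + j].
Proof.
have H0 : 0 < h + m by lia.
exists (p %/ (h + m)), (p %% (h + m) %/ k.+2), (p %% (h + m) %% k.+2).
rewrite -!divn_eq !ltn_pmod //; split=> //.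
rewrite ltn_divLR //; have := ltn_pmod p H0; lia.
Qed.

Lemma leq_crossings p d : crossings p <= crossings (p + d) <= crossings p + d.
Proof.
elim: d => [|d IH]; first by rewrite !addn0 leqnn.
by have := crossingsS (p + d); rewrite !addnS; lia.
Qed.

(** As [j < m], the count determines both half and segment, so the two positions differ only in
    their offsets. *)
Lemma crossings_flat p d : crossings (p + d) = crossings p -> d <= k.+1.
Proof.
have [a [j [u [ep _ uk jm ->]]]] := crossings_decomp p.
have [b [l [v [eq _ vk lm ->]]]] := crossings_decomp (p + d).
move=> e; have ba : b = a.
  by have := congr1 (divn^~ m) e; rewrite !divnMDl // !divn_small // !addn0.
have lj : l = j by lia.
by subst b l; lia.
Qed.

Lemma crossings_jump p d : d <= h + m -> crossings p + 3 <= crossings (p + d) ->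
  k + crossings (p + d) <= d + crossings p.
Proof.
have [a [j [u [ep lt_p uk jm ->]]]] := crossings_decomp p.
have [b [l [v [eq lt_q vk lm ->]]]] := crossings_decomp (p + d).
move=> dH ge3; rewrite !(mulnS _ k.+1) in ep eq lt_p lt_q.
have [ba|ba] : b = a \/ b = a.+1.
- suff : a <= b <= a.+1 by lia.
  apply/andP; split; rewrite leqNgt; apply/negP.
    by rewrite -(leq_pmul2r (_ : 0 < h + m)) ?mulSn //; lia.
  by rewrite -(leq_pmul2r (_ : 0 < h + m)) ?mulSn //; lia.
- subst b; have : (j + 3) * k.+1 <= l * k.+1 by rewrite leq_mul2r; lia.
  by rewrite mulnDl; lia.
(* The arc meets a half boundary, where a segment may be short; only [m.-1 * k.+1 < h] is available,
   hence one full segment fewer than in the previous case. *)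
- subst b; have : (j + 2) * k.+1 <= (l + m.-1) * k.+1.
    by move: ge3; rewrite leq_mul2r mulSn; lia.
  by move: eq; rewrite !mulnDl !mulSn; lia.
Qed.

Variables (n r : nat) (s : nat -> cube n) (w : nat -> cube r).
Hypotheses (walk_s : closed_walk h.*2 s) (spread_s : spread k h.*2 s).
Hypotheses (walk_w : closed_walk m.*2 w) (inj_w : forall i d, 0 < d < m.*2 -> w i != w (i + d)).

Definition expansion p : cube (n + r) :=
  [tuple of s (p - crossings p) ++ w (crossings p)].

Lemma crossings_le p : crossings p <= p.
Proof.
have c0 : crossings 0 = 0 by rewrite /crossings div0n mod0n div0n.
by have := leq_crossings 0 p; rewrite add0n c0; case/andP.
Qed.

Lemma expansion_closed : closed_walk (h + m).*2 expansion.
Proof.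
have [[sN s1] [wN w1]] := (walk_s, walk_w); split=> p; rewrite /expansion; last first.
  rewrite hamming_cat; have := crossings_le p; have /andP[] := crossingsS p.
  rewrite leq_eqVlt => /predU1P[<- _ pc|lt_c le_c _].
    by rewrite subSn // s1 hamming_xx.
  by rewrite (_ : crossings p.+1 = (crossings p).+1) ?subSS ?hamming_xx ?w1 //; lia.
have e : crossings (p + (h + m).*2) = crossings p + m.*2.
  by rewrite -addnn addnA !crossingsDr -addnA addnn.
rewrite e wN (_ : _ - _ = p - crossings p + h.*2) ?sN //.
by have := crossings_le p; lia.
Qed.

Lemma expansion_spread : spread k.+1 (h + m).*2 expansion.
Proof.
move=> p d; rewrite leq_double => dH; have [_ s1] := walk_s; have [_ w1] := walk_w.
(* Comparison with position [p + (h + m)] gives [t <= m] and [d - t <= h] for the number [t] of new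
   edges below; the latter is what [spread_s] requires. *)
have := leq_crossings (p + d) (h + m - d); rewrite -addnA subnKC // crossingsDr => tm.
have := leq_crossings p d; have := crossings_flat (p := p) (d := d).
have := crossings_jump (p := p) dH; have := crossings_le p; rewrite /expansion hamming_cat.
have : crossings p <= crossings (p + d) by have := leq_crossings p d; lia.
move: tm; move: (crossings p) (crossings (p + d)) => c c' tm cc'.
have [t ec] : exists t, c' = c + t by exists (c' - c); lia.
subst c'; move=> cp jump flat dt.
have -> : p + d - (c + t) = p - c + (d - t) by lia.
have hs := @spread_s (p - c) (d - t).
have hw2 : t = 2 -> hamming (w c) (w (c + 2)) = 2.
  by move=> t2; apply: hamming_step2 w1 _; apply: inj_w; lia.
have hw1 : 0 < t -> 0 < hamming (w c) (w (c + t)).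
  by move=> t0; rewrite lt0n hamming_eq0 inj_w //; lia.
have ps := walk_parity (p - c) (d - t) s1.
(* For [t = 0] one has [d <= k.+1]; if [d = k.+1], a distance at least [k] with the parity of [k.+1]
   is at least [k.+1]. *)
case: (posnP t) => [t0|t0].
  move: flat hs ps; rewrite t0 subn0 !addn0 hamming_xx; lia.
case: (eqVneq t 2) => [t2|t2]; first by move: hs; rewrite t2 hw2 //; lia.
(* For [t = 1] the new coordinates supply the one edge the old walk lacks; for [t >= 3] the old part
   already gives [k]. *)
by have := hw1 t0; lia.
Qed.

End Expansion.

(** * Parity of the length, ceilings and logarithms, and the final count *)

Lemma closed_walk_even n N (s : nat -> cube n) : closed_walk N s -> ~~ odd N.
Proof. by case=> sN s1; rewrite -(walk_parity 0 N s1) sN hamming_xx. Qed.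

Lemma log2_exp (R : realType) e : log2 ((2 ^ e)%:R : R) = e%:R%R.
Proof.
rewrite /log2 natrX lnXn // -[(_ *+ e)%R]mulr_natl mulfK //.
by rewrite gt_eqF // ln_gt0 // ltr1n.
Qed.

(** With [e = up_log 2 m > 0], [2 ^ e.-1 <= m - 1 < x <= m <= 2 ^ e], and [log2] is increasing. *)
Lemma ceil_log2 (R : realType) (x : R) m :
  (1 <= x)%R -> (Num.ceil x = m%:Z)%R -> (Num.ceil (log2 x) = (up_log 2 m)%:Z)%R.
Proof.
move=> x1 /eqP; rewrite ceil_eq => /andP[lt_x le_x].
have x0 : (0 < x)%R by lra.
have ln2 : (0 < ln 2 :> R)%R by rewrite ln_gt0 // ltr1n.
have le_log (y z : R) : (0 < y)%R -> (0 < z)%R -> (log2 y <= log2 z)%R = (y <= z)%R.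
  by move=> y0 z0; rewrite /log2 ler_pM2r ?invr_gt0 // ler_ln.
apply/eqP; rewrite ceil_eq; apply/andP; split; last first.
  rewrite -[X in (_ <= X)%R]/((up_log 2 m)%:R)%R -log2_exp le_log ?ltr0n ?expn_gt0 //.
  by apply: le_trans le_x _; rewrite ler_nat up_logP.
(* The case [e = 0] is separate because [e.-1] truncates; there [1 <= x] gives [-1 < log2 x]. *)
case: (posnP (up_log 2 m)) => [->|e0].
  by rewrite sub0r; apply: (@lt_le_trans _ _ 0%R); rewrite ?ltrz0 // /log2 divr_ge0 ?ln_ge0 ?ler1n.
have m1 : 1 < m by move: e0; rewrite up_log_gt0.
have -> : ((up_log 2 m)%:Z - 1 = (up_log 2 m).-1%:Z)%R by lia.
rewrite -[X in (X < _)%R]/((up_log 2 m).-1%:R)%R -log2_exp ltNge le_log ?ltr0n ?expn_gt0 // -ltNge.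
apply: le_lt_trans lt_x.
have -> : (m%:Z - 1 = m.-1%:Z)%R by lia.
by rewrite ler_nat; have := up_log_gtn (isT : 1 < 2) m1; lia.
Qed.

Theorem theorem1 (R : realType) (n k N : nat) (hn : 1 <= n) (hk : 1 <= k)
    (C : {set cube n}) (hC : circuit_code k C) (hN : #|C| = N)
    (hNk : 2 * (k + 1) <= N) :
  exists (r : nat) (C' : {set cube (n + r)}),
    [/\ (r%:Z = Num.ceil (log2 (N%:R / (2 * (k%:R + 1)) : R)) + 1)%R,
        circuit_code (k + 1) C' &
        (#|C'|%:Z = N%:Z + 2 * Num.ceil (N%:R / (2 * (k%:R + 1)) : R))%R].
Proof.
have [s ws ss] := code_walk hk hC; rewrite hN in ws ss.
pose h := N./2; have eN : N = h.*2 by rewrite even_halfK ?(closed_walk_even ws).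
(* As [N = h.*2], this rounded-up quotient of [h] by [k.+1] is the ceiling in the statement. *)
rewrite eN in ws ss; pose m := (h + k) %/ k.+1.
have le_h : k.+1 <= h by lia.
have dm := divn_eq (h + k) k.+1; have um := ltn_pmod (h + k) (ltn0Sn k); rewrite -/m in dm.
have m0 : 0 < m by rewrite divn_gt0 //; lia.
have em : m * k.+1 = k.+1 + m.-1 * k.+1 by rewrite -mulSn prednK.
have lt_h : m.-1 * k.+1 < h by lia.
have h_le : h <= m * k.+1 by lia.
(* The dimension [(up_log 2 m).+1] of [w] is the required [r]. *)
have [w ww iw] := cube_cycle m0 (up_logP m (isT : 1 < 2)).
have ce : (Num.ceil (N%:R / (2 * (k%:R + 1)) : R) = m%:Z)%R.
  have -> : (N%:R / (2 * (k%:R + 1)) = h%:R / k.+1%:R :> R)%R.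
    by rewrite natr1 eN -mul2n natrM -mulf_div divff ?mul1r // pnatr_eq0.
  apply/eqP; rewrite ceil_eq.
  have -> : (m%:Z - 1 = m.-1%:Z)%R by lia.
  rewrite -[(m.-1%:~R)%R]/(m.-1%:R)%R -[(m%:~R)%R]/(m%:R)%R.
  by rewrite ltr_pdivlMr ?ltr0n // ler_pdivrMr ?ltr0n // -!natrM ltr_nat ler_nat lt_h.
have x1 : (1 <= N%:R / (2 * (k%:R + 1)) :> R)%R.
  rewrite natr1 -natrM ler_pdivlMr ?ltr0n ?muln_gt0 // mul1r ler_nat; lia.
have ge2 : 2 < (h + m).*2 by lia.
have [code card] := walk_code (hk : 1 < k.+1) ge2 (expansion_closed m0 lt_h h_le ws ww)
  (expansion_spread m0 lt_h h_le ws ss ww iw).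
exists (up_log 2 m).+1; eexists; split; first by rewrite (ceil_log2 x1 ce) -addn1 PoszD.
  by rewrite addn1; exact: code.
rewrite ce card eN; lia.
Qed.
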